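(* Let $\Delta$ be a Delzant polytope in $\mathfrak t^*$ with $m$ facets and outward conormals $\mathbf n_1,\dots,\mathbf n_m$, and let $(\Delta,\mathbf b)$ be a mass linear pair, with $\langle \mathrm{Cm}(\Delta(k)),\mathbf b\rangle=\sum_{j=1}^m R_jk_j+C$ for all $k\in\mathcal C_\Delta$, where $R_1,\dots,R_m,C\in\mathbb R$ are constants. Let $k\in\mathcal C_\Delta$ be such that $\tilde k:=(k_1+1,\dots,k_m+1)$ also belongs to $\mathcal C_\Delta$, and let $d\in\mathfrak t^*$ be the element defined by $\mathrm{Cm}(\Delta(\tilde k))=\mathrm{Cm}(\Delta(k))+d$. Then $$\sum_{j=1}^m R_j\langle d,\mathbf n_j\rangle=\langle d,\mathbf b\rangle=\sum_{j=1}^m R_j.$$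
   Context: $T=(U(1))^n$, with Lie algebra $\mathfrak t\cong\mathbb R^n$ whose integer lattice is $\mathbb Z^n$. For $\mathbf n=(\mathbf n_1,\dots,\mathbf n_m)$ with $\mathbf n_j\in\mathfrak t$, and $k\in\mathbb R^m$, let $\Delta(\mathbf n,k)=\bigcap_{j=1}^m\{x\in\mathfrak t^*:\langle x,\mathbf n_j\rangle\le k_j\}$, a polytope with $m$ facets $F_j$ (contained in $\langle x,\mathbf n_j\rangle=k_j$) and outward conormals $\mathbf n_j$. It is Delzant if exactly $n$ facets meet at each vertex and the conormals are primitive integral vectors such that those of the facets meeting at any vertex form a $\mathbb Z$-basis of the integer lattice. The chamber $\mathcal C_\Delta$ of a polytope $\Delta=\Delta(\mathbf n,k^0)$ is the set of $k'\in\mathbb R^m$ such that $\Delta(\mathbf n,k')$, with facets $F'_j$, is analogous to $\Delta$: for every $J\subset\{1,\dots,m\}$, $\bigcap_{j\in J}F_j\neq\emptyset$ iff $\bigcap_{j\in J}F'_j\ne\emptyset$. For $k\in\mathcal C_\Delta$ write $\Delta(k)=\Delta(\mathbf n,k)$, and $\mathrm{Cm}(\Delta(k))\in\mathfrak t^*$ for its center of mass. The pair $(\Delta,\mathbf b)$, $\mathbf b\in\mathfrak t$, is mass linear if constants $R_j,C$ with the displayed property exist. *)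

(* Defs.v *)
From HB Require Import structures.
From mathcomp Require Import all_boot all_order all_algebra.
From mathcomp Require Import all_classical all_reals all_analysis.
Set Implicit Arguments.
Unset Strict Implicit.
Unset Printing Implicit Defensive.
Import Order.TTheory GRing.Theory Num.Theory.
Import numFieldNormedType.Exports.
Local Open Scope classical_set_scope.
Local Open Scope ring_scope.

(* Lebesgue measure on R^n, realised on n-tuples.  [measurableTypeR R] is R with
   its Borel sigma-algebra. *)

Definition tcons (R : realType) (n : nat)
    (p : measurableTypeR R * n.-tuple (measurableTypeR R)) :
    n.+1.-tuple (measurableTypeR R) :=
  [the n.+1.-tuple (measurableTypeR R) of p.1 :: p.2].

Lemma measurable_tcons (R : realType) (n : nat) :
  measurable_fun [set: measurableTypeR R * n.-tuple (measurableTypeR R)]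
    (@tcons R n).
Proof. by apply: measurable_cons; [exact: measurable_fst|exact: measurable_snd]. Qed.

Section lebesgue_succ.
Variables (R : realType) (n : nat).
Variable mu : {sigma_finite_measure set (n.-tuple (measurableTypeR R)) -> \bar R}.

Definition lebesgue_succ : set (n.+1.-tuple (measurableTypeR R)) -> \bar R :=
  pushforward (lebesgue_measure \x mu)%E (@tcons R n).

Let mu0 : lebesgue_succ set0 = 0%E.
Proof. by rewrite /lebesgue_succ /pushforward preimage_set0 measure0. Qed.

Let mu_ge0 A : (0 <= lebesgue_succ A)%E.
Proof. by rewrite /lebesgue_succ /pushforward; exact: measure_ge0. Qed.

Let mu_sigma_additive : semi_sigma_additive lebesgue_succ.
Proof.
move=> F mF tF mUF; rewrite /lebesgue_succ /pushforward preimage_bigcup.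
apply: measure_semi_sigma_additive.
- by move=> k; rewrite -[X in measurable X]setTI; exact: measurable_tcons.
- apply/trivIsetP => /= i j _ _ ij; rewrite -preimage_setI.
  by move/trivIsetP : tF => /(_ _ _ _ _ ij) ->//; rewrite preimage_set0.
- rewrite -preimage_bigcup -[X in measurable X]setTI.
  exact: measurable_tcons.
Qed.

HB.instance Definition _ := isMeasure.Build _ _ _ lebesgue_succ
  mu0 mu_ge0 mu_sigma_additive.

Let mu_sigma_finite : sigma_finite setT lebesgue_succ.
Proof.
have /sigma_finiteP[F [TF ndF Foo]] := sigma_finiteT (@lebesgue_measure R).
have /sigma_finiteP[G [TG ndG Goo]] := sigma_finiteT mu.
pose uncons (t : n.+1.-tuple (measurableTypeR R)) :
  measurableTypeR R * n.-tuple (measurableTypeR R) :=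
  (thead t, [tuple of behead t]).
have tK : cancel (@tcons R n) uncons.
  by case=> x t; rewrite /uncons /tcons theadE; congr pair; exact/val_inj.
have muncons : measurable_fun setT uncons.
  apply/measurable_fun_pairP; split.
    exact: (measurable_tnth (T := measurableTypeR R) ord0).
  exact: measurable_behead.
exists (fun i => uncons @^-1` (F i `*` G i)).
  rewrite -preimage_bigcup predeqE => t; split=> // _.
  have : setT (uncons t).1 by []. rewrite TF => -[i _ Fi].
  have : setT (uncons t).2 by []. rewrite TG => -[j _ Gj].
  exists (maxn i j) => //; split.
  - by move: Fi; exact/subsetPset/ndF/leq_maxl.
  - by move: Gj; exact/subsetPset/ndG/leq_maxr.
move=> i; have [mF Fi] := Foo i; have [mG Gi] := Goo i; split.
  by rewrite -[X in measurable X]setTI; apply: muncons => //; exact: measurableX.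
rewrite /lebesgue_succ /pushforward -comp_preimage.
rewrite (_ : uncons \o _ = id); last by apply/funext => p; exact: tK.
by rewrite preimage_id product_measure1E// lte_mul_pinfty// ge0_fin_numE.
Qed.

HB.instance Definition _ := @Measure_isSigmaFinite.Build _ _ _ lebesgue_succ
  mu_sigma_finite.

End lebesgue_succ.

Fixpoint lebesgue_tuple (R : realType) (n : nat) :
    {sigma_finite_measure set (n.-tuple (measurableTypeR R)) -> \bar R} :=
  match n with
  | 0 => dirac (nil_tuple (measurableTypeR R))
  | n'.+1 => lebesgue_succ (lebesgue_tuple R n')
  end.

Definition row_of_tuple (R : realType) (n : nat)
  (t : n.-tuple (measurableTypeR R)) : 'rV[R]_n := \row_i tnth t i.

Definition center_of_mass (R : realType) (n : nat) (A : set 'rV[R]_n) :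
    'rV[R]_n :=
  let D := @row_of_tuple R n @^-1` A in
  \row_i ((\int[lebesgue_tuple R n]_(t in D) row_of_tuple t ord0 i)
          / fine (lebesgue_tuple R n D)).

(* Elements of t = R^n are column vectors, elements of t^* are row vectors. *)

Definition pairing (R : realType) (n : nat) (x : 'rV[R]_n) (b : 'cV[R]_n) : R :=
  (x *m b) ord0 ord0.

Definition polytope (R : realType) (n m : nat) (nu : 'I_m -> 'cV[R]_n)
    (k : 'rV[R]_m) : set 'rV[R]_n :=
  \bigcap_j [set x | pairing x (nu j) <= k ord0 j].

Definition facet (R : realType) (n m : nat) (nu : 'I_m -> 'cV[R]_n)
    (k : 'rV[R]_m) (j : 'I_m) : set 'rV[R]_n :=
  polytope nu k `&` [set x | pairing x (nu j) = k ord0 j].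

(* The affine hull of A has dimension d: A contains d+1 affinely independent
   points x0, x0 + M_1, ..., x0 + M_d whose affine span contains A. *)
Definition affine_dim (R : realType) (n : nat) (A : set 'rV[R]_n) (d : nat) :
    Prop :=
  exists (x0 : 'rV[R]_n) (M : 'M[R]_(d, n)),
    [/\ A x0, row_free M, forall i, A (x0 + row i M)
      & forall x, A x -> (x - x0 <= M)%MS].

(* Polytope with m (pairwise distinct) facets.  [facet nu k j] is always a face
   (the inequality number j turned into an equality); it is a facet when its
   codimension in the polytope is one. *)
Definition has_m_facets (R : realType) (n m : nat) (nu : 'I_m -> 'cV[R]_n)
    (k : 'rV[R]_m) : Prop :=
  [/\ bounded_set (polytope nu k),
      forall j, exists d, affine_dim (polytope nu k) d.+1 /\
                          affine_dim (facet nu k j) d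
    & injective (facet nu k)].

Definition vertex (R : realType) (n : nat) (A : set 'rV[R]_n) (v : 'rV[R]_n) :
    Prop :=
  A v /\ forall (x y : 'rV[R]_n) (t : R), A x -> A y -> 0 < t < 1 ->
    v = t *: x + (1 - t) *: y -> x = y.

Definition integral_vec (R : realType) (n : nat) (v : 'cV[R]_n) : Prop :=
  forall i, v i ord0 \is a Num.int.

(* The case c = 0 excludes v = 0. *)
Definition primitive_vec (R : realType) (n : nat) (v : 'cV[R]_n) : Prop :=
  integral_vec v /\
  forall (c : int) (w : 'cV[R]_n), integral_vec w -> v = c%:~R *: w -> `|c| = 1.

Definition lattice_basis (R : realType) (n m : nat) (nu : 'I_m -> 'cV[R]_n)
    (J : {set 'I_m}) : Prop :=
  [/\ forall j, j \in J -> integral_vec (nu j),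
      forall v, integral_vec v ->
        exists a : 'I_m -> int, v = \sum_(j in J) (a j)%:~R *: nu j
    & forall a : 'I_m -> int, \sum_(j in J) (a j)%:~R *: nu j = 0 ->
        forall j, j \in J -> a j = 0].

Definition facets_at (R : realType) (n m : nat) (nu : 'I_m -> 'cV[R]_n)
    (k : 'rV[R]_m) (v : 'rV[R]_n) : {set 'I_m} :=
  finset (fun j => `[< facet nu k j v >]).

Definition Delzant (R : realType) (n m : nat) (nu : 'I_m -> 'cV[R]_n)
    (k : 'rV[R]_m) : Prop :=
  [/\ has_m_facets nu k,
      forall j, primitive_vec (nu j)
    & forall v, vertex (polytope nu k) v ->
        #|facets_at nu k v| = n /\ lattice_basis nu (facets_at nu k v)].

(* The intersection over the empty J is the whole space on both sides.  When
   (nu, k) is Delzant, this condition already forces polytope nu k' to be bounded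
   with facets facet nu k' j, so this is not required separately. *)
Definition analogous (R : realType) (n m : nat) (nu : 'I_m -> 'cV[R]_n)
    (k k' : 'rV[R]_m) : Prop :=
  forall J : {set 'I_m},
    \bigcap_(j in [set` J]) facet nu k j !=set0 <->
    \bigcap_(j in [set` J]) facet nu k' j !=set0.

Definition chamber (R : realType) (n m : nat) (nu : 'I_m -> 'cV[R]_n)
    (k0 : 'rV[R]_m) : set 'rV[R]_m :=
  [set k' | analogous nu k0 k'].

Definition mass_linear_with (R : realType) (n m : nat) (nu : 'I_m -> 'cV[R]_n)
    (k0 : 'rV[R]_m) (b : 'cV[R]_n) (r : 'I_m -> R) (C : R) : Prop :=
  forall k, chamber nu k0 k ->
    pairing (center_of_mass (polytope nu k)) b =
      \sum_(j < m) r j * k ord0 j + C.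

(* Main.v *)
Require Import Defs.
From HB Require Import structures.
From mathcomp Require Import all_boot all_order all_algebra.
From mathcomp Require Import all_classical all_reals all_analysis.
From mathcomp Require Import measurable_realfun lra.
Import Order.TTheory GRing.Theory Num.Theory.
Import numFieldNormedType.Exports.
Local Open Scope classical_set_scope.
Local Open Scope ring_scope.

(* Both equalities say that [\sum_j r_j (k'_j - k_j) = <Cm(k') - Cm(k), b>] for
   two points of the chamber.  Subtracting mass linearity at [k] from mass
   linearity at [k + (1, ..., 1)] gives the second one.  For the first, translate:
   the support numbers [k0_j + <d, nu_j>] define the polytope of [k0] moved by
   [d], which lies in the chamber and whose center of mass is moved by [d].

   The last point needs the polytope to have positive volume ([x / 0 = 0] would
   otherwise make its center of mass [0]).  A point of a bounded polytope
   satisfying a maximal number of equalities is a vertex, since otherwise one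
   could slide along a segment until one more inequality becomes tight.  At a
   vertex of a Delzant polytope the active conormals form a basis, so one can move
   off all of them at once into the interior. *)

(** * Lebesgue measure on tuples: invariance under translations, volume of cubes *)

Section translation_invariance.
Context {R : realType}.

Definition rtranslate (c : R) : measurableTypeR R -> measurableTypeR R :=
  fun x : R => x + c.

Definition translate (n : nat) (a : 'rV[R]_n)
    (t : n.-tuple (measurableTypeR R)) : n.-tuple (measurableTypeR R) :=
  [tuple (tnth t i : R) + a ord0 i | i < n].

Definition ptranslate (n : nat) (c : R) (a : 'rV[R]_n)
    (p : measurableTypeR R * n.-tuple (measurableTypeR R)) :
    measurableTypeR R * n.-tuple (measurableTypeR R) :=
  (rtranslate c p.1, translate n a p.2).

Lemma measurable_rtranslate (c : R) : measurable_fun setT (rtranslate c).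
Proof. by apply: measurable_funD => //; exact: measurable_id. Qed.

HB.instance Definition _ (c : R) :=
  isMeasurableFun.Build _ _ _ _ _ (measurable_rtranslate c).

Lemma measurable_translate (n : nat) (a : 'rV[R]_n) :
  measurable_fun setT (translate n a).
Proof.
apply/measurable_fun_tnthP => i.
rewrite (_ : _ \o _ =
  rtranslate (a ord0 i) \o (@tnth n (measurableTypeR R) ^~ i)).
  by apply: measurableT_comp => //; exact: measurable_tnth.
by apply/funext => t /=; rewrite tnth_mktuple.
Qed.

HB.instance Definition _ (n : nat) (a : 'rV[R]_n) :=
  isMeasurableFun.Build _ _ _ _ _ (measurable_translate n a).

Lemma measurable_ptranslate (n : nat) (c : R) (a : 'rV[R]_n) :
  measurable_fun setT (ptranslate n c a).
Proof.
apply/measurable_fun_pairP; split.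
  by apply: (measurableT_comp (measurable_rtranslate c)); exact: measurable_fst.
by apply: (measurableT_comp (measurable_translate n a)); exact: measurable_snd.
Qed.

HB.instance Definition _ (n : nat) (c : R) (a : 'rV[R]_n) :=
  isMeasurableFun.Build _ _ _ _ _ (measurable_ptranslate n c a).

(** By uniqueness of Lebesgue measure it suffices to compare lengths of the intervals []x, y]],
    whose preimages are []x - c, y - c]]. *)
Lemma lebesgue_measure_rtranslate (c : R) (A : set (measurableTypeR R)) :
  measurable A ->
  lebesgue_measure (rtranslate c @^-1` A) = lebesgue_measure A.
Proof.
move=> mA; rewrite -[LHS]/(pushforward (@lebesgue_measure R) (rtranslate c) A).
apply/esym/lebesgue_measure_unique => //= _ [[x y]] _ <-.
rewrite /pushforward.
rewrite (_ : _ @^-1` _ = [set` `]x - c, y - c]]); last first.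
  by apply/seteqP; split=> z /=; rewrite !in_itv /= ltrBlDr lerBrDr.
by rewrite !lebesgue_measure_itv/= !lte_fin ltrD2r -!EFinB opprB addrA subrK.
Qed.

Lemma translate_tcons (n : nat) (a : 'rV[R]_n.+1)
    (p : measurableTypeR R * n.-tuple (measurableTypeR R)) :
  translate n.+1 a (tcons p) =
  tcons (ptranslate n (a ord0 ord0) (\row_i a ord0 (lift ord0 i)) p).
Proof.
apply/eq_from_tnth => i; rewrite tnth_mktuple /tcons.
case: (unliftP ord0 i) => [j ->|->].
  by rewrite !tnthS tnth_mktuple mxE.
by rewrite !tnth0.
Qed.

(** Induction on [n]: through [tcons] a translation acts separately on head and tail, and a product
    measure is determined by its values on rectangles. *)
Lemma lebesgue_tuple_translate (n : nat) (a : 'rV[R]_n)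
    (A : set (n.-tuple (measurableTypeR R))) : measurable A ->
  lebesgue_tuple R n (translate n a @^-1` A) = lebesgue_tuple R n A.
Proof.
elim: n a A => [|n IH] a A mA.
  have id0 t : translate 0 a t = t by apply: eq_from_tnth => -[].
  by congr (lebesgue_tuple R 0 _); apply/seteqP; split => t /=; rewrite id0.
rewrite /= /lebesgue_succ /pushforward.
pose a' : 'rV[R]_n := \row_i a ord0 (lift ord0 i).
pose phi := ptranslate n (a ord0 ord0) a'.
have -> : @tcons R n @^-1` (translate n.+1 a @^-1` A) =
          phi @^-1` (@tcons R n @^-1` A).
  by apply/seteqP; split => p /=; rewrite translate_tcons.
have mB : measurable (@tcons R n @^-1` A).
  by rewrite -[X in measurable X]setTI; exact: measurable_tcons.
apply/esym.
apply: (product_measure_unique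
  (m' := pushforward (lebesgue_measure \x lebesgue_tuple R n)%E phi)) => //.
move=> X Y mX mY.
transitivity ((lebesgue_measure \x lebesgue_tuple R n)%E
  ((rtranslate (a ord0 ord0) @^-1` X) `*` (translate n a' @^-1` Y))) => //.
rewrite product_measure1E.
- by congr (_ * _)%E; [exact: lebesgue_measure_rtranslate|exact: IH].
- by rewrite -[X in measurable X]setTI; exact: measurable_rtranslate.
- by rewrite -[X in measurable X]setTI; exact: measurable_translate.
Qed.

(** A closed cube of side [e *+ 2]; comparison with such cubes bounds the volume of a polytope from
    both sides. *)
Definition box (n : nat) (c : 'rV[R]_n) (e : R) :
    set (n.-tuple (measurableTypeR R)) :=
  [set t | forall i, `|(tnth t i : R) - c ord0 i| <= e].

Lemma measurable_box (n : nat) (c : 'rV[R]_n) (e : R) : measurable (box n c e).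
Proof.
rewrite (_ : box _ _ _ = \bigcap_(i in [set: 'I_n]) 
  (setT `&` (@tnth n (measurableTypeR R) ^~ i) @^-1` 
     [set` `[c ord0 i - e, c ord0 i + e]])).
  apply: fin_bigcap_measurable => // i _.
  by apply: measurable_tnth => //; exact: measurable_itv.
apply/seteqP; split => t /= ht i; last first.
  by have [_ /=] := ht i I; rewrite in_itv /= ler_distl.
by move=> _; split => //=; rewrite in_itv /= -ler_distl.
Qed.

Lemma lebesgue_tuple_box (n : nat) (c : 'rV[R]_n) (e : R) : 0 < e ->
  lebesgue_tuple R n (box n c e) = ((e *+ 2) ^+ n)%:E.
Proof.
move=> e0; elim: n c => [|n IH] c.
  by rewrite /= diracE mem_set//; case.
rewrite /= /lebesgue_succ /pushforward.
pose c' : 'rV[R]_n := \row_i c ord0 (lift ord0 i).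
have -> : @tcons R n @^-1` box n.+1 c e =
    [set` `[c ord0 ord0 - e, c ord0 ord0 + e]] `*` box n c' e.
  apply/seteqP; split => -[x t] /=.
    move=> h; split => [|i].
      by have := h ord0; rewrite tnth0 in_itv /= ler_distl.
    by have := h (lift ord0 i); rewrite tnthS mxE.
  rewrite in_itv /= -ler_distl => -[hx ht] i.
  case: (unliftP ord0 i) => [j ->|->]; last by rewrite tnth0.
  by rewrite tnthS; have := ht j; rewrite mxE.
rewrite product_measure1E; [|exact: measurable_itv|exact: measurable_box].
rewrite exprS EFinM; congr (_ * _)%E; last exact: IH.
apply: etrans (lebesgue_measure_itv _) _.
by rewrite /= lte_fin ltrD2l gtrN// -EFinB opprD opprK addrACA subrr add0r.
Qed.

End translation_invariance.

(** * Polytopes: effect of translations, existence of vertices, dual bases *)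

Section polytopes.
Context {R : realType} {n m : nat}.
Implicit Types (x y a u : 'rV[R]_n) (v : 'cV[R]_n) (nu : 'I_m -> 'cV[R]_n).

Lemma pairingD x y v : pairing (x + y) v = pairing x v + pairing y v.
Proof. by rewrite /pairing mulmxDl mxE. Qed.

Lemma pairingB x y v : pairing (x - y) v = pairing x v - pairing y v.
Proof. by rewrite /pairing mulmxBl !mxE. Qed.

Lemma pairingZ c x v : pairing (c *: x) v = c * pairing x v.
Proof. by rewrite /pairing -scalemxAl mxE. Qed.

Lemma pairingE x v : pairing x v = \sum_i x ord0 i * v i ord0.
Proof. by rewrite /pairing mxE. Qed.

Lemma polytopeP nu k x :
  polytope nu k x <-> forall j, pairing x (nu j) <= k ord0 j.
Proof. by split=> [h j|h j _]; exact: h. Qed.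

Lemma in_facets_at nu k x j : polytope nu k x ->
  (j \in facets_at nu k x) = (pairing x (nu j) == k ord0 j).
Proof.
move=> Px; rewrite inE; apply/asboolP/eqP => [[_]//|h]; by split.
Qed.

Definition support_shift nu a : 'rV[R]_m := \row_j pairing a (nu j).

Lemma polytope_translate nu k a x :
  polytope nu (k + support_shift nu a) (x + a) <-> polytope nu k x.
Proof.
by split=> /polytopeP h; apply/polytopeP => j; have := h j;
  rewrite !mxE pairingD lerD2r.
Qed.

Lemma facet_translate nu k a j x :
  facet nu (k + support_shift nu a) j (x + a) <-> facet nu k j x.
Proof.
split=> -[/polytope_translate Px /= e]; split => //=; last first.
  by rewrite !mxE pairingD e.
by move: e; rewrite !mxE pairingD => /addIr.
Qed.

Lemma chamber_translate nu k a : chamber nu k (k + support_shift nu a).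
Proof.
move=> J; split=> -[x hx].
  by exists (x + a) => j Jj; apply/facet_translate; exact: hx.
exists (x - a) => j Jj; apply/(facet_translate _ _ a).
by rewrite subrK; exact: hx.
Qed.

Lemma bounded_row_entries (A : set 'rV[R]_n) : bounded_set A ->
  exists2 e : R, 0 < e & forall x, A x -> forall i, `|x ord0 i| <= e.
Proof.
case=> M [_ hM]; exists (`|M| + 1); first by rewrite ltr_wpDl.
move=> x Ax i; apply: le_trans (_ : `|x| <= _).
  rewrite [leRHS]mx_normrE.
  exact: (le_bigmax _ (fun ij : 'I_1 * 'I_n => `|x ij.1 ij.2|) (ord0, i)).
by apply: hM Ax; rewrite ltr_pwDr// ler_norm.
Qed.

(** The ray from [x] in direction [u] stays in the polytope, which is bounded. *)
Lemma polytope_recession nu k x u : bounded_set (polytope nu k) ->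
  polytope nu k x -> (forall j, pairing u (nu j) <= 0) -> u = 0.
Proof.
move=> /bounded_row_entries[e e0 he] /polytopeP Px hu.
apply/eqP/contraT => /eqP u0.
have [i ui] : exists i, u ord0 i != 0.
  apply: contrapT => h; apply: u0; apply/rowP => i; rewrite mxE.
  by apply/eqP/contraT => ui; case: h; exists i.
(* Chosen so that [s * u_i] has absolute value [e + |x_i| + 1], one more than the bound [e] on
   entries allows. *)
pose s := (e + `|x ord0 i| + 1) / `|u ord0 i|.
have s0 : 0 <= s by rewrite divr_ge0// !addr_ge0// ltW.
have : polytope nu k (x + s *: u).
  apply/polytopeP => j; rewrite pairingD pairingZ.
  by rewrite -[leRHS]addr0 lerD// mulr_ge0_le0.
move=> /he /(_ i); rewrite !mxE => h.
have : `|s * u ord0 i| <= e + `|x ord0 i|.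
  rewrite -[s * _](addrK (x ord0 i)) [s * _ + _]addrC.
  by rewrite (le_trans (ler_normB _ _))// lerD2r.
by rewrite normrM ger0_norm// /s divfK ?normr_eq0// gerDl ler10.
Qed.

Lemma exists_vertex nu k : (0 < n)%N -> bounded_set (polytope nu k) ->
  polytope nu k !=set0 -> exists x, vertex (polytope nu k) x.
Proof.
move=> n0 bP [x0 Px0].
pose Q c := `[< exists2 x, polytope nu k x & #|facets_at nu k x| = c >].
have exQ : exists c, Q c.
  by exists #|facets_at nu k x0|; apply/asboolP; exists x0.
have ubQ c : Q c -> (c <= m)%N.
  by move=> /asboolP[x _ <-]; rewrite -[leqRHS]card_ord max_card.
case: (ex_maxnP exQ ubQ) => c /asboolP[x Px xc] maxc.
exists x; split => // y z t Py Pz /andP[t0 t1] xE.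
apply: contrapT => yz.
(* If inequality [j] is tight at a point strictly between [y] and [z], it is tight at both ends. *)
have hact j : j \in facets_at nu k x -> pairing (y - z) (nu j) = 0.
  rewrite in_facets_at// pairingB => /eqP.
  rewrite xE pairingD !pairingZ => e.
  move/polytopeP : Py => /(_ j) hy; move/polytopeP : Pz => /(_ j) hz.
  nra.
(* Otherwise [y - z] would be a recession direction, hence zero. *)
have [i ui] : exists i, 0 < pairing (y - z) (nu i).
  apply: contrapT => h; apply: yz; apply/eqP; rewrite -subr_eq0; apply/eqP.
  apply: (polytope_recession nu k x) => // j; rewrite leNgt.
  by apply/negP => hj; apply: h; exists j.
pose u := y - z.
(* The time at which the ray from [x] along [u] reaches hyperplane [j]; the least one, over the
   hyperplanes it approaches, is when it first meets a new one. *)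
pose slope j := (k ord0 j - pairing x (nu j)) / pairing u (nu j).
have [j uj jmin] :=
  @arg_minP _ _ _ i (fun j => 0 < pairing u (nu j)) slope ui.

have sj0 : 0 <= slope j.
  by apply: divr_ge0; [rewrite subr_ge0; move/polytopeP : Px|exact: ltW].
pose x' := x + slope j *: u.
have Px' : polytope nu k x'.
  apply/polytopeP => l; rewrite pairingD pairingZ.
  have [ul|ul] := ltP 0 (pairing u (nu l)).
    by rewrite -lerBrDl -ler_pdivlMr// jmin.
  move/polytopeP : Px => /(_ l) hl.
  by rewrite -[leRHS]addr0 lerD// mulr_ge0_le0.
(* Old equalities persist because [u] pairs to zero with them; [j] is new because [u] pairs
   positively with it. *)
have sub : facets_at nu k x \proper facets_at nu k x'.
  apply/properP; split.
    apply/fintype.subsetP => l lx; move: (lx); rewrite !in_facets_at//.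
    by rewrite pairingD pairingZ hact// mulr0 addr0.
  exists j; rewrite in_facets_at//.
    by rewrite pairingD pairingZ /slope divfK ?(gt_eqF uj)// addrC subrK.
  by apply/negP => jx; move: uj; rewrite /u hact ?ltxx// in_facets_at.
have : (#|facets_at nu k x'| <= c)%N by apply: maxc; apply/asboolP; exists x'.
by rewrite leqNgt -xc proper_card.
Qed.

(** Expanding the standard basis in the [nu j] gives a right inverse [B] of the matrix [N] with
    columns [nu j]. Both are square as [#|J| = n], so the rows of [B] form the dual basis, and [w]
    is minus their sum. *)
Lemma lattice_basis_dual nu (J : {set 'I_m}) : #|J| = n ->
  lattice_basis nu J -> exists w, forall j, j \in J -> pairing w (nu j) = -1.
Proof.
move=> Jn [_ span _].
have /choice[A hA] : forall i : 'I_n, exists a : 'I_m -> int,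
    delta_mx i ord0 = \sum_(j in J) (a j)%:~R *: nu j.
  move=> i; apply: span => l; rewrite mxE; exact: natr_int.
pose N : 'M[R]_(n, #|J|) := \matrix_(i, l) nu (enum_val l) i ord0.
pose B : 'M[R]_(#|J|, n) := \matrix_(l, i) (A i (enum_val l))%:~R.
have NB : N *m B = 1%:M.
  apply/matrixP => i i'; rewrite !mxE.
  have := congr1 (fun M : 'cV[R]_n => M i ord0) (hA i').
  rewrite mxE andbT summxE => ->.
  rewrite [RHS]big_enum_val; apply: eq_bigr => l _.
  by rewrite !mxE mulrC.
have BN : B *m N = 1%:M.
  by move: N B NB; rewrite Jn => N B /mulmx1C.
exists (const_mx (-1) *m B) => j jJ.
pose c : 'rV[R]_#|J| := const_mx (-1).
transitivity ((c *m B *m N) ord0 (enum_rank_in jJ j)); last first.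
  by rewrite -mulmxA BN mulmx1 mxE.
rewrite pairingE mxE; apply: eq_bigr => i _; congr (_ * _).
by rewrite mxE enum_rankK_in.
Qed.
End polytopes.

(** Each inequality holds for all small [e > 0], and there are finitely many. *)
Lemma small_positive {R : realType} {m : nat} (c s : 'I_m -> R) :
  (forall j, 0 < s j) -> exists2 e : R, 0 < e & forall j, c j * e < s j.
Proof.
move=> s0.
have small j : \forall e \near (0 : R)^'+, c j * e < s j.
  near=> e.
  have e0 : 0 < e by near: e; exact: nbhs_right_gt.
  (* Adding 1 keeps the divisor positive when [c j = 0]. *)
  apply: (@le_lt_trans _ _ ((`|c j| + 1) * e)).
    by rewrite ler_pM2r// (le_trans (ler_norm _))// lerDl.
  rewrite mulrC -ltr_pdivlMr ?ltr_wpDl//.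
  by near: e; apply: nbhs_right_lt; rewrite divr_gt0// ltr_wpDl.
have /filter_ex[e [e0 he]] :
    \forall e \near (0 : R)^'+, 0 < e /\ forall j, c j * e < s j.
  by apply: filterI; [exact: nbhs_right_gt|exact: (filter_forall _ small)].
by exists e.
Unshelve. all: by end_near. Qed.

(** * Interior points, volume and center of mass of polytopes *)

Section volume.
Context {R : realType} {n m : nat}.
Implicit Types (k : 'rV[R]_m) (x y a u : 'rV[R]_n) (v : 'cV[R]_n) (nu : 'I_m -> 'cV[R]_n).

Lemma Delzant_interior nu k : (0 < n)%N -> Delzant nu k ->
  exists x, forall j, pairing x (nu j) < k ord0 j.
Proof.
move=> n0 [[bP fP _] _ vP].
have [P0|P0] := pselect (polytope nu k !=set0); last first.
  (* Any index [j] would provide a point of the empty polytope, so there is no inequality to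
     check. *)
  exists 0 => j; case: P0; have [d [[x0 [M [Px _ _ _]]] _]] := fP j.
  by exists x0.
have [p pv] := exists_vertex nu k n0 bP P0.
have [Pp _] := pv.
have [cJ bJ] := vP p pv.
have [w hw] := lattice_basis_dual nu _ cJ bJ.
have act j : j \in facets_at nu k p -> pairing p (nu j) = k ord0 j.
  by rewrite in_facets_at// => /eqP.
have slack j : j \notin facets_at nu k p -> pairing p (nu j) < k ord0 j.
  by rewrite in_facets_at// => h; rewrite lt_neqAle h /=; move/polytopeP : Pp.
(* Off the active set the bound is the slack at [p]; on it [w] pairs to -1, so the value 1 is just a
   positive placeholder. *)
have [|e e0 he] := small_positive (fun j => pairing w (nu j))
  (fun j => if j \in facets_at nu k p then 1 else k ord0 j - pairing p (nu j)).
  by move=> j; case: ifPn => // /slack; rewrite subr_gt0.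
exists (p + e *: w) => j; rewrite pairingD pairingZ.
have [jJ|jJ] := boolP (j \in facets_at nu k p).
  by rewrite hw// act// mulrN1 gtrBl.
by have := he j; rewrite (negPf jJ) mulrC ltrBrDl.
Qed.

Lemma pairing_row_of_tuple (t : n.-tuple (measurableTypeR R)) v :
  pairing (row_of_tuple t) v = \sum_i (tnth t i : R) * v i ord0.
Proof. by rewrite pairingE; apply: eq_bigr => i _; rewrite mxE. Qed.

Lemma measurable_polytope nu k :
  measurable (@row_of_tuple R n @^-1` polytope nu k).
Proof.
rewrite (_ : _ @^-1` _ = \bigcap_(j in [set: 'I_m])
  (setT `&` [set t : n.-tuple (measurableTypeR R) |
     \sum_i (tnth t i : R) * nu j i ord0 <= cst (k ord0 j) t])); last first.
  apply/seteqP; split=> t /= h.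
    by move=> j _; split => //=; rewrite -pairing_row_of_tuple; exact: h.
  apply/polytopeP => j; rewrite pairing_row_of_tuple.
  by have [_] := h j I.
apply: fin_bigcap_measurable => // j _.
apply: measurable_fun_le => //.
apply: measurable_sum => i.
apply: measurable_funM => //; exact: measurable_tnth.
Qed.

Lemma polytope_volume_gt0 nu k x : (forall j, pairing x (nu j) < k ord0 j) ->
  (0 < lebesgue_tuple R n (@row_of_tuple R n @^-1` polytope nu k))%E.
Proof.
move=> hx.
(* Moving every coordinate by at most [e] changes the pairing with [nu j] by at most [s j * e], so a
   small cube around [x] fits inside. *)
pose s j := \sum_i `|nu j i ord0|.
have [|e e0 he] := small_positive s (fun j => k ord0 j - pairing x (nu j)).
  by move=> j; rewrite subr_gt0.
apply: (@lt_le_trans _ _ (lebesgue_tuple R n (box n x e))).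
  by rewrite lebesgue_tuple_box// lte_fin exprn_gt0// mulrn_wgt0.
apply: le_measure; rewrite ?inE; [exact: measurable_box|exact: measurable_polytope|].
move=> t ht; apply/polytopeP => j.
rewrite -[leRHS](subrK (pairing x (nu j))) -lerBlDr -pairingB.
apply: le_trans (ltW (he j)); rewrite pairingE /s mulr_suml.
apply: ler_sum => i _; rewrite (le_trans (ler_norm _))// normrM mulrC.
by rewrite ler_wpM2l// !mxE; exact: ht.
Qed.

Lemma polytope_volume_lty nu k : bounded_set (polytope nu k) ->
  (lebesgue_tuple R n (@row_of_tuple R n @^-1` polytope nu k) < +oo)%E.
Proof.
move=> /bounded_row_entries[e e0 he].
apply: (@le_lt_trans _ _ (lebesgue_tuple R n (box n 0 e))); last first.
  by rewrite lebesgue_tuple_box// ltry.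
apply: le_measure; rewrite ?inE; [exact: measurable_polytope|exact: measurable_box|].
by move=> t /= /he h i; rewrite mxE subr0; have := h i; rewrite mxE.
Qed.

(** After a change of variables, the integral of coordinate [i] over the moved polytope gains [a_i]
    times the volume; dividing by the volume leaves [a_i]. *)
Lemma center_of_mass_translate nu k a : bounded_set (polytope nu k) ->
  (0 < lebesgue_tuple R n (@row_of_tuple R n @^-1` polytope nu k))%E ->
  center_of_mass (polytope nu (k + support_shift nu a)) =
  center_of_mass (polytope nu k) + a.
Proof.
move=> bP vol0; apply/rowP => i; rewrite !mxE.
set P := _ @^-1` polytope nu k; set P' := _ @^-1` _.
set mu := lebesgue_tuple R n.
have mP : measurable P by exact: measurable_polytope.
have mP' : measurable P' by exact: measurable_polytope.
have PE : translate n a @^-1` P' = P.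
  have tE t : row_of_tuple (translate n a t) = row_of_tuple t + a.
    by apply/rowP => l; rewrite !mxE tnth_mktuple.
  by apply/seteqP; split=> t /=; rewrite /P' /= tE => /polytope_translate.
have volE : mu P' = mu P by rewrite -PE lebesgue_tuple_translate.
have voly : (mu P < +oo)%E by exact: polytope_volume_lty.
(* Finiteness matters as well as positivity, since [fine] sends [+oo] to 0. *)
have vol_neq0 : fine (mu P) != 0.
  by rewrite gt_eqF// fine_gt0// vol0.
pose f (t : n.-tuple (measurableTypeR R)) : R := tnth t i.
have mf : measurable_fun setT f by exact: measurable_tnth.
have int_bounded (g : n.-tuple (measurableTypeR R) -> R) (M : R) :
    measurable_fun setT g -> (forall t, P t -> `|g t| <= M) ->
    mu.-integrable P (EFin \o g).
  move=> mg gM; apply: measurable_bounded_integrable => //.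
    exact: measurable_funTS.
  exists M; split; first exact: num_real.
  by move=> N MN t Pt /=; rewrite (le_trans (gM t Pt))// ltW.
have [e e0 he] := bounded_row_entries _ bP.
have fe t : P t -> `|f t| <= e by move=> /he /(_ i); rewrite mxE.
have intf : mu.-integrable P (EFin \o f) by exact: (int_bounded f e).
have inta : mu.-integrable P (EFin \o cst (a ord0 i)).
  exact: (int_bounded _ `|a ord0 i|).
have intE : \int[mu]_(t in P') f t = \int[mu]_(t in P) (f t + a ord0 i).
  have fT t : f (translate n a t) = f t + a ord0 i.
    by rewrite /f tnth_mktuple.
  rewrite /Rintegral; congr fine.
  (* By invariance [mu] may be replaced by its own pushforward, which moves the integral back to
     [P]. *)
  transitivity (\int[pushforward mu (translate n a)]_(t in P') (f t)%:E)%E.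
    apply: eq_measure_integral => A mA _.
    by apply/esym; exact: lebesgue_tuple_translate.
  rewrite integral_pushforward//.
  - by rewrite PE; apply: eq_integral => t _ /=; rewrite fT.
  - exact/measurable_EFinP.
  - rewrite PE (_ : _ \o _ = EFin \o (fun t => f t + a ord0 i)); last first.
      by apply/funext => t /=; rewrite fT.
    apply: (int_bounded _ (e + `|a ord0 i|)).
      exact: measurable_funD.
    by move=> t Pt; rewrite (le_trans (ler_normD _ _))// lerD2r fe.
have -> : \int[mu]_(t in P') row_of_tuple t ord0 i = \int[mu]_(t in P') f t.
  by apply: eq_Rintegral => t _; rewrite mxE.
have -> : \int[mu]_(t in P) row_of_tuple t ord0 i = \int[mu]_(t in P) f t.
  by apply: eq_Rintegral => t _; rewrite mxE.
by rewrite intE volE RintegralD// Rintegral_cst// mulrDl mulfK.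
Qed.
End volume.

Theorem proposition13 (R : realType) (n m : nat) (nu : 'I_m -> 'cV[R]_n)
    (k0 : 'rV[R]_m) (b : 'cV[R]_n) (r : 'I_m -> R) (C : R)
    (k : 'rV[R]_m) (d : 'rV[R]_n)
    (hDelzant : Delzant nu k0)
    (hlin : mass_linear_with nu k0 b r C)
    (hk : chamber nu k0 k)
    (hk1 : chamber nu k0 (k + const_mx 1))
    (hd : center_of_mass (polytope nu (k + const_mx 1)) =
          center_of_mass (polytope nu k) + d) :
  \sum_(j < m) r j * pairing d (nu j) = pairing d b /\
  pairing d b = \sum_(j < m) r j.
Proof.
(* Mass linearity at [h + g] minus mass linearity at [h]; used with [g] the all-ones vector and with
   [g] the support shift of [d]. *)
have sumD (h : 'rV[R]_m) : chamber nu k0 h ->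
    forall g : 'rV[R]_m, chamber nu k0 (h + g) ->
    forall x : 'rV[R]_n, center_of_mass (polytope nu (h + g)) =
      center_of_mass (polytope nu h) + x ->
    \sum_(j < m) r j * g ord0 j = pairing x b.
  move=> hh g hg x hx.
  have := hlin _ hg; rewrite hx pairingD (hlin _ hh).
  under [in RHS]eq_bigr do rewrite mxE mulrDr.
  by rewrite big_split /= [in RHS]addrAC => /addrI ->.
split; last first.
  by rewrite -(sumD _ hk _ hk1 _ hd); apply: eq_bigr => j _; rewrite mxE mulr1.
(* The translation is made at [k0] rather than [k], because [hDelzant] gives boundedness and an
   interior point there. *)
have ch0 : chamber nu k0 k0 by [].
rewrite -(sumD _ ch0 _ (chamber_translate nu k0 d) d).
  by apply: eq_bigr => j _; rewrite mxE.
have [[bP _ _] _ _] := hDelzant.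
(* In dimension 0 all row vectors coincide. *)
have [n0|n0] := posnP n.
  by subst n; apply/rowP => -[].
apply: center_of_mass_translate => //.
have [x hx] := Delzant_interior nu k0 n0 hDelzant.
exact: (polytope_volume_gt0 nu k0 x hx).
Qed.
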